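(* Let $B_0=\{y^{\beta_1},\dots,y^{\beta_r}\}$ be the set of the first $r$ monomials (in the graded lexicographic order) whose images in $\mathbb{C}[Y]$ are linearly independent, and let $g_1,\dots,g_N\in\mathbb{C}[y]$ be generators of the vanishing ideal $I(Y)$. Then, for $G\in\mathbb{C}^{[r]\times\partial B_1}$, the polynomial system $$\varphi[G](y)=0$$ has $r$ solutions (counting multiplicities) and they belong to $Y$ if and only if $$[M_i(G),M_j(G)]=0\quad(1\le i<j\le n)\qquad\text{and}\qquad \operatorname{NF}(g_i;G)=0\quad(i=1,\dots,N).$$
   Context: Let $X=\{x\in\mathbb{C}^{n+1}: h_1(x)=\cdots=h_M(x)=0\}$ with $h_i$ homogeneous polynomials in $x=(x_0,\dots,x_n)$, and let $Y=\{y\in\mathbb{C}^n: h_i(1,y_1,\dots,y_n)=0,\ i=1,\dots,M\}$ be its dehomogenization. Write $y=(y_1,\dots,y_n)$; $I(Y)\subseteq\mathbb{C}[y]$ is the vanishing ideal of $Y$ and $\mathbb{C}[Y]=\mathbb{C}[y]/I(Y)$. Monomials are ordered by the graded lexicographic order $1<y_1<\cdots<y_n<y_1^2<y_1y_2<\cdots$. The integer $r$ is given, and $B_0$ is obtained by going through the monomials in increasing order and keeping the first $r$ whose images in $\mathbb{C}[Y]$ are linearly independent. Put $B_1=B_0\cup y_1B_0\cup\cdots\cup y_nB_0$ and $\partial B_1=B_1\setminus B_0$; monomials are identified with their exponents. A matrix $G\in\mathbb{C}^{[r]\times\partial B_1}$ is written $G=(c_{i,\alpha})_{i\in[r],\,\alpha\in\partial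 B_1}$, and for $\alpha\in\partial B_1$ $$\varphi[G,\alpha]:=\sum_{i=1}^r c_{i,\alpha}y^{\beta_i}-y^\alpha,\qquad \varphi[G]:=(\varphi[G,\alpha])_{\alpha\in\partial B_1}.$$ $J_G$ is the ideal of $\mathbb{C}[y]$ generated by the polynomials in $\varphi[G]$. For $p\in\mathbb{C}[y]$, $\operatorname{NF}(p;G)$ is the normal form (remainder) of $p$ on division by $\varphi[G]$ by the border division algorithm. That is: set $B_k=B_{k-1}\cup y_1B_{k-1}\cup\cdots\cup y_nB_{k-1}$ for $k\ge2$, and call the least $k$ with $t\in B_k$ the index of a monomial $t$; while the current polynomial contains a monomial $t$ of index $k\ge1$, take such a $t$ of maximal index, write $t=t'y^\alpha$ with $\alpha\in\partial B_1$ and $\deg t'=k-1$ (taking the first possible $\alpha$ in a fixed ordering of $\partial B_1$), and replace $t$ by $t'\sum_{i=1}^r c_{i,\alpha}y^{\beta_i}$. The result lies in $\operatorname{Span}B_0$ and satisfies $p-\operatorname{NF}(p;G)\in J_G$. For $1\le i\le n$, $M_i(G)\in\mathbb{C}^{r\times r}$ is the matrix with $(M_i(G))_{s,t}=1$ if $\beta_t+e_i\in B_0$ and $\beta_s=\beta_t+e_i$; $(M_i(G))_{s,t}=0$ if $\beta_t+e_i\in B_0$ and $\beta_s\ne\beta_t+e_i$; $(M_i(G))_{s,t}=c_{s,\beta_t+e_i}$ if $\beta_t+e_i\in\partial B_1$. Here $e_i$ is the $i$-th standard unit vector and $[P,Q]=PQ-QP$.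
   Formalization: ''They belong to Y'' is read with multiplicities: each solution lies in Y and I(Y) lies locally in J_G there. For bare points the claim fails: Y={0,1}, B_0={1,y}, G=0 has the double solution 0 in Y, but NF(y^2-y;G)=-y. *)

(* Defs.v *)
From mathcomp Require Import all_boot all_order all_algebra.
From mathcomp Require Import reals complex mpoly.

Set Implicit Arguments.
Unset Strict Implicit.
Unset Printing Implicit Defensive.

Import Order.TTheory GRing.Theory.
Local Open Scope ring_scope.

Section Varieties.
Variables (K : fieldType) (n : nat).

Definition ideal_gen (T : finType) (F : T -> {mpoly K[n]}) (p : {mpoly K[n]}) :=
  exists a : T -> {mpoly K[n]}, p = \sum_t a t * F t.

(* (y_1, ..., y_n) |-> (1, y_1, ..., y_n) *)
Definition affine_chart (y : {ffun 'I_n -> K}) (j : 'I_n.+1) : K :=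
  if unlift ord0 j is Some i then y i else 1.

Definition dehomog_variety (M : nat) (h : 'I_M -> {mpoly K[n.+1]})
    (y : {ffun 'I_n -> K}) :=
  forall k, (h k).@[affine_chart y] = 0.

Definition vanishing_ideal (Y : {ffun 'I_n -> K} -> Prop) (p : {mpoly K[n]}) :=
  forall y, Y y -> p.@[y] = 0.

End Varieties.

Section Multiplicity.
Variables (K : fieldType) (n : nat).
Implicit Types (J I : {mpoly K[n]} -> Prop) (u : {ffun 'I_n -> K}).

(* The local ring O_u of affine n-space at u, inside the rational functions. *)
Definition local_ring u (q : {fraction {mpoly K[n]}}) :=
  exists a s : {mpoly K[n]}, s.@[u] != 0 /\ q = tofrac a / tofrac s.

(* The extension J O_u of an ideal J to O_u. *)
Definition local_ideal J u (q : {fraction {mpoly K[n]}}) :=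
  exists a s : {mpoly K[n]}, [/\ J a, s.@[u] != 0 & q = tofrac a / tofrac s].

(* dim_K (O_u / J O_u) = d, i.e. this quotient has a basis of size d. *)
Definition multiplicity J u (d : nat) :=
  exists e : 'I_d -> {fraction {mpoly K[n]}},
    [/\ forall i, local_ring u (e i),
        forall q, local_ring u q ->
          exists c : 'I_d -> K,
            local_ideal J u (q - \sum_i tofrac (c i)%:MP * e i)
      & forall c : 'I_d -> K,
          local_ideal J u (\sum_i tofrac (c i)%:MP * e i) ->
          forall i, c i = 0].

Definition solution (T : finType) (F : T -> {mpoly K[n]}) u :=
  forall t, (F t).@[u] = 0.

Definition has_solutions_with_mult (T : finType) (F : T -> {mpoly K[n]})
    (r : nat) :=
  exists (s : seq {ffun 'I_n -> K}) (mu : {ffun 'I_n -> K} -> nat),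
    [/\ uniq s,
        forall u, u \in s <-> solution F u,
        forall u, u \in s -> multiplicity (ideal_gen F) u (mu u)
      & (\sum_(u <- s) mu u)%N = r].

(* The solutions, counted with multiplicities, belong to Y: each solution u is
   a point of Y, and the fat point it carries lies in Y too, that is, I(Y) O_u
   is contained in J O_u for the ideal J of the system. So u has the same
   multiplicity when the system is solved in Y as in affine space.
   Membership of the bare points would ignore the multiplicities: for n = 1 and
   Y = {0, 1}, the only solution of y^2 = 0 is a point of Y, but it is double in
   affine space and simple in Y. *)
Definition solutions_belong_with_mult (T : finType) (F : T -> {mpoly K[n]})
    (Y : {ffun 'I_n -> K} -> Prop) :=
  forall u, solution F u ->
    Y u /\
    forall p, vanishing_ideal Y p -> local_ideal (ideal_gen F) u (tofrac p).

End Multiplicity.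

Section MonomialBasis.
Variables (K : fieldType) (n : nat).
Implicit Types (m t : 'X_{1..n}) (s B : seq 'X_{1..n}).

(* 1 < y_1 < ... < y_n < y_1^2 < y_1 y_2 < ... : in a given degree, the larger
   exponent at the first difference makes the smaller monomial. This reverses,
   in each degree, the order that mpoly puts on 'X_{1..n}. *)
Definition grlex_lt m1 m2 :=
  (mdeg m1 < mdeg m2)%N ||
  (mdeg m1 == mdeg m2) &&
  [exists i : 'I_n, (m2 i < m1 i)%N &&
     [forall j : 'I_n, (j < i)%N ==> (m1 j == m2 j)]].

(* For s without repetition: the images of the monomials of s modulo I are
   linearly independent. *)
Definition indep_mod (I : {mpoly K[n]} -> Prop) s :=
  forall c : 'X_{1..n} -> K,
    I (\sum_(m <- s) c m *: 'X_[m]) -> forall m, m \in s -> c m = 0.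

(* beta lists the first r monomials with independent images: a monomial that is
   passed over depends on those already kept. *)
Definition first_indep (I : {mpoly K[n]} -> Prop) (r : nat)
    (beta : r.-tuple 'X_{1..n}) :=
  [/\ sorted grlex_lt beta,
      indep_mod I beta
    & forall m, m \notin beta -> has (grlex_lt m) beta ->
        ~ indep_mod I (rcons [seq b <- beta | grlex_lt b m] m)].

Definition expand B : seq 'X_{1..n} :=
  undup (B ++ [seq (m + U_(i))%MM | i <- enum 'I_n, m <- B]).

Definition B_ B (k : nat) := iter k expand B.

Definition border B := [seq m <- B_ B 1 | m \notin B].

(* The least k such that t \in B_ B k. If 1 \in B, then k <= mdeg t, so the
   search always succeeds. *)
Definition index_of B t :=
  find (fun k => t \in B_ B k) (iota 0 (mdeg t).+1).

End MonomialBasis.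

Section BorderSystem.
Variables (K : fieldType) (n r : nat) (beta : r.-tuple 'X_{1..n}).
Variable G : 'I_r -> seq_sub (border beta) -> K.
Implicit Types (a t : 'X_{1..n}) (p : {mpoly K[n]}).

(* c_{i,a}; the junk value 0 is taken only for a outside the border. *)
Definition gcoef (i : 'I_r) a : K :=
  if insub a is Some b then G i b else 0.

Definition tail a : {mpoly K[n]} :=
  \sum_(i < r) gcoef i a *: 'X_[tnth beta i].

Definition phi (a : seq_sub (border beta)) : {mpoly K[n]} :=
  \sum_(i < r) G i a *: 'X_[tnth beta i] - 'X_[val a].

Definition mult_mx (i : 'I_n) : 'M[K]_r :=
  \matrix_(s, t)
    let m := (tnth beta t + U_(i))%MM in
    if m \in beta then (tnth beta s == m)%:R else gcoef s m.

(* bd is the chosen ordering of the border. *)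
Variable bd : seq 'X_{1..n}.

(* t of index k >= 1 is rewritten with the first a in bd such that t = t' a
   with deg t' = k - 1. *)
Definition rewrite_mnm t : {mpoly K[n]} :=
  if [seq a <- bd | (a <= t)%MM && (mdeg (t - a) == (index_of beta t).-1)]
    is a :: _
  then 'X_[t - a] * tail a else 'X_[t].

Definition max_index p := (\max_(t <- msupp p) index_of beta t)%N.

(* A monomial of maximal index in p. *)
Definition head_mnm p :=
  nth 0%MM (msupp p)
    (find (fun t => index_of beta t == max_index p) (msupp p)).

Definition division_step p :=
  if max_index p is 0 then p else
  let t := head_mnm p in p + p@_t *: (rewrite_mnm t - 'X_[t]).

(* Steps only create monomials of index below that of the rewritten one, so at
   most size (B_ beta k) steps are made at index k; see NF_span. *)
Definition NF p :=
  iter (\sum_(1 <= k < (max_index p).+1) size (B_ beta k)) division_step p.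

End BorderSystem.

Definition commutator (K : pzRingType) (r : nat) (P Q : 'M[K]_r) : 'M[K]_r :=
  P *m Q - Q *m P.

Section BorderIndex.
Variable n : nat.
Implicit Types (m t : 'X_{1..n}) (B : seq 'X_{1..n}).

Lemma mem_expand B t :
  reflect (t \in B \/ exists i m, m \in B /\ t = (m + U_(i))%MM) (t \in expand B).
Proof.
rewrite mem_undup mem_cat; apply: (iffP orP) => -[H|H]; try by left.
- by right; case/allpairsP: H => -[i m] /= [_ mB ->]; exists i, m.
- by right; case: H => i [m [mB ->]]; apply/allpairsP; exists (i, m); rewrite mem_enum.
Qed.

Lemma B_S B k : B_ B k.+1 = expand (B_ B k). Proof. by []. Qed.

Lemma mnm_pred m d : mdeg m = d.+1 ->
  exists i m', m = (m' + U_(i))%MM /\ mdeg m' = d.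
Proof.
move=> md; have /existsP[i mi] : [exists i, (0 < m i)%N].
  apply: contra_eqT md => /existsPn H.
  by rewrite mdegE big1 // => i _; apply/eqP; rewrite -leqn0 leqNgt.
have le : (U_(i) <= m)%MM.
  by apply/mnm_lepP => j; rewrite mnm1E; case: eqP => [<-|].
exists i, (m - U_(i))%MM; split; first by rewrite submK.
by apply: succn_inj; rewrite -md -{2}(submK le) mdegD mdeg1 addn1.
Qed.

Lemma B_add B k m t : t \in B_ B k -> (t + m)%MM \in B_ B (k + mdeg m).
Proof.
move=> tB; move dE : (mdeg m) => d; elim: d m dE => [|d IH] m dE.
  by move/eqP: dE; rewrite mdeg_eq0 => /eqP ->; rewrite addm0 addn0.
have [i [m' [-> d']]] := mnm_pred dE.
by rewrite addnS; apply/mem_expand; right; exists i, (t + m')%MM; rewrite IH // addmA.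
Qed.

Lemma index_of_min B t k : t \in B_ B k -> (k <= mdeg t)%N ->
  (index_of B t <= k)%N.
Proof.
move=> tB kt; rewrite leqNgt; apply/negP => H.
by have := before_find 0%N H; rewrite nth_iota ?add0n ?tB ?ltnS.
Qed.

Section WithUnit.
Variable B : seq 'X_{1..n}.
Hypothesis B1 : 0%MM \in B.

Lemma index_of_mem t : (index_of B t <= mdeg t)%N /\ t \in B_ B (index_of B t).
Proof.
have H : t \in B_ B (mdeg t).
  by rewrite -[X in X \in _]add0m -[X in B_ _ X]add0n; apply: B_add.
have le := index_of_min H (leqnn _); split; first exact: le.
have hs : has (fun k => t \in B_ B k) (iota 0 (mdeg t).+1).
  by apply/hasP; exists (mdeg t) => //; rewrite mem_iota add0n /= ltnS leqnn.
have := nth_find 0%N hs; rewrite -/(index_of B t) nth_iota ?add0n ?ltnS //; apply.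
Qed.

Lemma index_of0 t : (index_of B t == 0)%N = (t \in B).
Proof.
apply/eqP/idP => [E|tB]; first by have [_] := index_of_mem t; rewrite E.
by apply/eqP; rewrite -leqn0; apply: index_of_min.
Qed.

Lemma border_factor k t : t \in B_ B k -> t \notin B ->
  exists2 a, a \in border B & (a <= t)%MM && (mdeg (t - a) < k)%N.
Proof.
elim: k t => [|k IH] t; first by move=> /= ->.
move/mem_expand=> [tB tN|[i [m [mB E]]] tN].
  by have [a ab /andP[le lt]] := IH _ tB tN; exists a => //; rewrite le ltnW.
have [mB0|mN] := boolP (m \in B).
  exists t; last by rewrite lepm_refl -[in X in (X - t)%MM](add0m t) addmK mdeg0.
  by rewrite mem_filter tN; apply/mem_expand; right; exists i, m.
have [a ab /andP[le lt]] := IH _ mB mN; exists a => //.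
have E2 : t = ((m - a) + U_(i) + a)%MM by rewrite -addmA [(U_(i) + a)%MM]addmC addmA submK.
rewrite E2 addmK mdegD mdeg1 addn1 ltnS lt andbT.
by apply/mnm_lepP => j; rewrite mnmDE leq_addl.
Qed.

End WithUnit.
End BorderIndex.

Section NormalForm.
Variables (K : fieldType) (n r : nat) (beta : r.-tuple 'X_{1..n}).
Variable G : 'I_r -> seq_sub (border beta) -> K.
Variable bd : seq 'X_{1..n}.
Hypothesis bdE : perm_eq bd (border beta).
Hypothesis beta1 : 0%MM \in beta.
Implicit Types (a t : 'X_{1..n}) (p : {mpoly K[n]}).
Local Notation idx := (index_of beta).

Lemma rewrite_mnmP t : (0 < idx t)%N ->
  exists2 a, a \in border beta &
    [/\ (a <= t)%MM, mdeg (t - a) = (idx t).-1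
      & rewrite_mnm G bd t = 'X_[t - a] * tail G a].
Proof.
move=> it; rewrite /rewrite_mnm.
case E: filter => [|a l].
  have [_ tB] := index_of_mem beta1 t.
  have tN : t \notin beta by rewrite -index_of0 // -lt0n.
  have [a ab /andP[le lt]] := border_factor tB tN.
  suff : a \in [::] by [].
  rewrite -E mem_filter le (perm_mem bdE) ab andbT /= eqn_leq.
  rewrite -ltnS prednK // lt /= -ltnS prednK //.
  move: ab; rewrite mem_filter => /andP[aN aB].
  have := B_add (t - a) aB; rewrite addmC submK // add1n => tB'.
  apply: index_of_min => //.
  rewrite -[in X in (_ <= X)%N](submK le) mdegD -addn1 leq_add2l lt0n mdeg_eq0.
  by apply: contraNneq aN => ->.
have : a \in a :: l by rewrite mem_head.
rewrite -E mem_filter => /andP[/andP[le /eqP d] ab].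
by exists a; [rewrite -(perm_mem bdE) | split].
Qed.

Lemma rewrite_mnm_supp t : (0 < idx t)%N ->
  {in msupp (rewrite_mnm G bd t), forall m, (idx m < idx t)%N}.
Proof.
move=> it m; have [a _ [le d ->]] := rewrite_mnmP it.
rewrite /tail mulr_sumr => /msupp_sum_le /flattenP[s /mapP[i _ ->]].
rewrite -scalerAr -mpolyXD => /msuppZ_le; rewrite msuppX inE => /eqP ->.
rewrite -(prednK it) ltnS -d addmC; apply: index_of_min.
  by rewrite -[X in B_ _ X]add0n; apply: B_add; apply: mem_tnth.
by rewrite mdegD leq_addl.
Qed.

Local Notation K_ := (max_index beta).

Lemma idx_max p t : t \in msupp p -> (idx t <= K_ p)%N.
Proof. by move=> tp; rewrite /max_index; apply: (@leq_bigmax_seq _ _ xpredT idx). Qed.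

Lemma head_mnmP p : (0 < K_ p)%N ->
  head_mnm beta p \in msupp p /\ idx (head_mnm beta p) = K_ p.
Proof.
move=> kp; have H : has (fun t => idx t == K_ p) (msupp p).
  have [t tp E] : exists2 t, t \in msupp p & idx t == K_ p.
    move: kp; rewrite /max_index; elim: (msupp p) => [|x s IH]; first by rewrite big_nil.
    rewrite big_cons; case: (leqP (idx x) (\max_(t <- s) idx t)%N) => [le|lt].
      by move=> /IH [t ts tE]; exists t; rewrite // inE ts orbT.
    by move=> _; exists x; rewrite ?mem_head.
  by apply/hasP; exists t.
split; first by apply: mem_nth; rewrite -has_find.
exact/eqP/(nth_find 0%MM H).
Qed.

Lemma division_stepE p : (0 < K_ p)%N ->
  division_step G bd p =
  p - p@_(head_mnm beta p) *: 'X_[head_mnm beta p]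
    + p@_(head_mnm beta p) *: rewrite_mnm G bd (head_mnm beta p).
Proof.
rewrite /division_step; case: (K_ p) => // k _ /=.
by rewrite scalerBr addrA addrAC.
Qed.

Lemma division_step_supp p m : (0 < K_ p)%N -> m \in msupp (division_step G bd p) ->
  (m \in msupp p) && (m != head_mnm beta p) || (idx m < K_ p)%N.
Proof.
move=> kp; rewrite division_stepE //; have [hp hE] := head_mnmP kp.
move: hp hE; set t := head_mnm _ _ => hp hE /msuppD_le; rewrite mem_cat => /orP[].
  rewrite (perm_mem (msupp_rem p t)) mem_rem_uniq ?msupp_uniq // inE /= andbC.
  by move=> ->.
move=> /msuppZ_le H; apply/orP; right; rewrite -hE.
by apply: rewrite_mnm_supp => //; rewrite hE.
Qed.

Let cnt p := count (fun t => idx t == K_ p) (msupp p).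
Let pot p := (cnt p + \sum_(1 <= k < K_ p) size (B_ beta k))%N.

Lemma cnt_le p : (cnt p <= size (B_ beta (K_ p)))%N.
Proof.
rewrite /cnt -size_filter; apply: uniq_leq_size.
  by rewrite filter_uniq ?msupp_uniq.
move=> t; rewrite mem_filter => /andP[/eqP <- _].
by have [] := index_of_mem beta1 t.
Qed.

Lemma pot_le p : (0 < K_ p)%N ->
  (pot p <= \sum_(1 <= k < (K_ p).+1) size (B_ beta k))%N.
Proof. by move=> kp; rewrite /pot big_nat_recr //= addnC leq_add2l cnt_le. Qed.

Lemma pot_step p : (0 < K_ p)%N -> (0 < K_ (division_step G bd p))%N ->
  (pot (division_step G bd p) < pot p)%N.
Proof.
move=> kp; set q := division_step _ _ _ => kq.
have [hp hE] := head_mnmP kp; have [hq hqE] := head_mnmP kq.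
have c0 : (0 < cnt p)%N.
  by rewrite -has_count; apply/hasP; exists (head_mnm beta p); rewrite ?hE.
have le : (K_ q <= K_ p)%N.
  apply/bigmax_leqP_seq => m /division_step_supp -/(_ kp) /orP[/andP[mp _] _|/ltnW] //.
  exact: idx_max.
move: le; rewrite leq_eqVlt => /orP[/eqP E|lt].
  rewrite /pot E ltn_add2r /cnt E -!size_filter.
  set f := [seq t <- msupp p | _]; set f' := [seq t <- msupp q | _].
  have hf : head_mnm beta p \in f by rewrite mem_filter hE eqxx.
  have uf : uniq f by rewrite filter_uniq ?msupp_uniq.
  have : (size f' <= size (rem (head_mnm beta p) f))%N.
    apply: uniq_leq_size; first by rewrite filter_uniq ?msupp_uniq.
    move=> m; rewrite mem_filter mem_rem_uniq // inE mem_filter /= => /andP[mE mq].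
    rewrite mE /=; have := division_step_supp kp mq.
    by rewrite (eqP mE) ltnn orbF andbC.
  rewrite size_rem // => le'; apply: leq_ltn_trans le' _.
  by rewrite ltn_predL; case: (f) hf.
apply: leq_ltn_trans (pot_le kq) _; rewrite /pot.
rewrite (big_cat_nat _ (n := (K_ q).+1) (p := K_ p)) //= addnCA.
by rewrite -[X in (X < _)%N]addn0 ltn_add2l addn_gt0 c0.
Qed.

Lemma NF_span p : {subset msupp (NF G bd p) <= beta}.
Proof.
suff H : K_ (NF G bd p) = 0%N.
  by move=> t /idx_max; rewrite H leqn0 index_of0.
suff H k q : (0 < K_ q)%N -> (pot q <= k)%N -> K_ (iter k (division_step G bd) q) = 0%N.
  rewrite /NF; case: (posnP (K_ p)) => [E|kp]; first by rewrite E big_nil.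
  by apply: H => //; apply: pot_le.
elim: k q => [|k IH] q kq; have [hp hE] := head_mnmP kq.
  rewrite leqn0 addn_eq0 => /andP[/eqP c0 _].
  have : has (fun t => idx t == K_ q) (msupp q).
    by apply/hasP; exists (head_mnm beta q); rewrite ?hE.
  by rewrite has_count -/(cnt q) c0.
move=> le; rewrite iterSr; case: (posnP (K_ (division_step G bd q))) => [E|kq'].
  by elim: k {IH le} => //= k IHk; rewrite {1}/division_step IHk.
by apply: IH => //; rewrite -ltnS (leq_trans (pot_step kq kq')).
Qed.

Lemma NF_mod p : ideal_gen (phi G) (p - NF G bd p).
Proof.
have J0 : ideal_gen (phi G) 0.
  by exists (fun=> 0); rewrite big1 // => i _; rewrite mul0r.
have JD q q' : ideal_gen (phi G) q -> ideal_gen (phi G) q' -> ideal_gen (phi G) (q + q').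
  move=> [a ->] [b ->]; exists (fun v => a v + b v).
  by rewrite -big_split; apply: eq_bigr => v _; rewrite mulrDl.
have JM c q : ideal_gen (phi G) q -> ideal_gen (phi G) (c * q).
  move=> [a ->]; exists (fun v => c * a v).
  by rewrite mulr_sumr; apply: eq_bigr => v _; rewrite mulrA.
have Jp v0 : ideal_gen (phi G) (phi G v0).
  exists (fun v => (v == v0)%:R); rewrite (bigD1 v0) //= eqxx mul1r big1 ?addr0 //.
  by move=> v /negPf ->; rewrite mul0r.
have step q : ideal_gen (phi G) (q - division_step G bd q).
  case: (posnP (K_ q)) => [E|kq]; first by rewrite /division_step E subrr.
  have [hp hE] := head_mnmP kq; rewrite division_stepE //.
  rewrite -hE in kq; have [a ab [le d ->]] := rewrite_mnmP kq.
  set c := q@__; set t := head_mnm _ _.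
  have -> : q - (q - c *: 'X_[t] + c *: ('X_[t - a] * tail G a)) =
      (- c%:MP * 'X_[t - a]) * phi G (SeqSub ab).
    have -> : phi G (SeqSub ab) = tail G a - 'X_[a].
      congr (_ - _); apply: eq_bigr => i _; congr (_ *: _).
      by rewrite /gcoef; case: insubP => [b _ /= bE|]; [congr (G i _); apply/val_inj | rewrite ab].
    rewrite opprD opprD opprK addrA addrA subrr add0r mulrBr -mulrA !mulNr opprK.
    by rewrite -[c%:MP * _ * _]mulrA -mpolyXD submK // !mul_mpolyC addrC.
  by apply: (JM).
rewrite /NF; elim: (\sum_(_ <= _ < _) _)%N => [|k IH] /=; first by rewrite subrr.
by have := JD _ _ IH (step (iter k (division_step G bd) p)); rewrite addrA subrK.
Qed.
End NormalForm.

(* Main.v *)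
(** Let J be the ideal of the system. Border division shows that B_0 always spans the quotient
    of the polynomial ring by J. This quotient is therefore finite dimensional, hence the product
    of its localizations at the solutions, and the number of solutions counted with multiplicity
    is its dimension: it is r exactly when B_0 is a basis modulo J. If B_0 is a basis, the M_i(G)
    are the matrices of multiplication by the variables, so they commute. Conversely, B_0 is
    closed under division, and commuting M_i(G) make the space of coordinate vectors a module
    on which J acts by 0 on the coordinate vector of 1, while each monomial of B_0 sends this
    vector to its own coordinate vector; so B_0 is independent modulo J. Finally, the fat points
    of the solutions lie in Y iff I(Y) is contained in J locally at every solution, that is, iff
    it is contained in J, and for a basis B_0 this means that the g_k have normal form 0. *)

Require Import Defs.
From mathcomp Require Import all_boot all_order all_algebra.
From mathcomp Require Import ring reals complex mpoly.
From mathcomp Require boolp.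

Set Implicit Arguments.
Unset Strict Implicit.
Unset Printing Implicit Defensive.

Import Order.TTheory GRing.Theory.
Local Open Scope ring_scope.

(** * Linear algebra modulo an ideal *)

Section IdealModulo.
Variables (K : fieldType) (A : comAlgType K).
Implicit Types (I : A -> Prop) (p q a : A).

Definition is_ideal I :=
  [/\ I 0, forall p q, I p -> I q -> I (p + q) & forall a p, I p -> I (a * p)].

(** Coefficients form a row vector, so that a change of family is right multiplication by a matrix
    ([comb_mulmx]). *)
Definition comb d (c : 'rV[K]_d) (e : 'I_d -> A) : A := \sum_i c 0 i *: e i.

Definition spans_mod I d (e : 'I_d -> A) := forall p, exists c, I (p - comb c e).

Definition free_mod I d (e : 'I_d -> A) := forall c, I (comb c e) -> c = 0.

Definition basis_mod I d (e : 'I_d -> A) := spans_mod I e /\ free_mod I e.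

Lemma combD d (c c' : 'rV_d) (e : 'I_d -> A) :
  comb (c + c') e = comb c e + comb c' e.
Proof. by rewrite /comb -big_split; apply: eq_bigr => i _; rewrite mxE scalerDl. Qed.

Lemma combZ d k (c : 'rV_d) (e : 'I_d -> A) : comb (k *: c) e = k *: comb c e.
Proof. by rewrite /comb scaler_sumr; apply: eq_bigr => i _; rewrite mxE scalerA. Qed.

Lemma comb0 d (e : 'I_d -> A) : comb 0 e = 0.
Proof. by rewrite -(scale0r 0) combZ scale0r. Qed.

Lemma combB d (c c' : 'rV_d) (e : 'I_d -> A) :
  comb (c - c') e = comb c e - comb c' e.
Proof. by rewrite combD -scaleN1r combZ scaleN1r. Qed.

Lemma comb_delta d i (e : 'I_d -> A) : comb (delta_mx 0 i) e = e i.
Proof.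
rewrite /comb (bigD1 i) //= mxE !eqxx scale1r big1 ?addr0 // => j ji.
by rewrite mxE (negPf ji) andbF scale0r.
Qed.

Lemma comb_mulmx m d (c : 'rV_m) (P : 'M_(m, d)) (e : 'I_d -> A) :
  comb (c *m P) e = comb c (fun i => comb (row i P) e).
Proof.
rewrite /comb; under eq_bigr => j _ do rewrite mxE scaler_suml.
rewrite exchange_big; apply: eq_bigr => i _.
by rewrite scaler_sumr; apply: eq_bigr => j _; rewrite mxE scalerA.
Qed.

Lemma comb_mull d a (c : 'rV_d) (e : 'I_d -> A) :
  a * comb c e = comb c (fun i => a * e i).
Proof. by rewrite /comb mulr_sumr; apply: eq_bigr => i _; rewrite scalerAr. Qed.

Section Ideal.
Variables (I : A -> Prop) (idI : is_ideal I).

Lemma ideal0 : I 0. Proof. by case: idI. Qed.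
Lemma idealD p q : I p -> I q -> I (p + q). Proof. by case: idI => _ + _; apply. Qed.
Lemma idealMl a p : I p -> I (a * p). Proof. by case: idI => _ _; apply. Qed.
Lemma idealMr a p : I p -> I (p * a). Proof. by rewrite mulrC; apply: idealMl. Qed.
Lemma idealN p : I p -> I (- p). Proof. by rewrite -mulN1r; apply: idealMl. Qed.
Lemma idealB p q : I p -> I q -> I (p - q).
Proof. by move=> Ip /idealN; apply: idealD. Qed.
Lemma idealZ k p : I p -> I (k *: p).
Proof. by rewrite -mulr_algl; apply: idealMl. Qed.
Lemma ideal_sum (T : Type) (s : seq T) (P : pred T) (F : T -> A) :
  (forall t, P t -> I (F t)) -> I (\sum_(t <- s | P t) F t).
Proof. by move=> IF; apply: big_ind => //; [apply: ideal0 | apply: idealD]. Qed.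
Lemma ideal_trans q p p' : I (p - q) -> I (q - p') -> I (p - p').
Proof. by move=> /idealD H /H; rewrite addrA subrK. Qed.
Lemma ideal_sym p q : I (p - q) -> I (q - p).
Proof. by move/idealN; rewrite opprB. Qed.
Lemma ideal_cong p q : I (p - q) -> I q -> I p.
Proof. by move=> /idealD H /H; rewrite subrK. Qed.

Lemma ideal_congM p q p' q' : I (p - q) -> I (p' - q') -> I (p * p' - q * q').
Proof.
move=> pq pq'; have -> : p * p' - q * q' = p' * (p - q) + q * (p' - q') by ring.
by apply: idealD; apply: idealMl.
Qed.
Lemma ideal_congX p q k : I (p - q) -> I (p ^+ k - q ^+ k).
Proof.
move=> pq; elim: k => [|k IH]; first by rewrite subrr; apply: ideal0.
by rewrite !exprS; apply: ideal_congM.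
Qed.

Lemma ideal_comb d (c : 'rV_d) (e e' : 'I_d -> A) :
  (forall i, I (e i - e' i)) -> I (comb c e - comb c e').
Proof.
move=> ee'; rewrite /comb -sumrB; apply: ideal_sum => i _.
by rewrite -scalerBr; apply: idealZ.
Qed.

(** * Bases and dimension of the quotient by an ideal *)

Lemma spans_modP d m (b : 'I_d -> A) (e : 'I_m -> A) : spans_mod I b ->
  exists P : 'M_(m, d), forall i, I (e i - comb (row i P) b).
Proof.
move=> sp; have /fin_all_exists[c cP] := fun i => sp (e i).
by exists (\matrix_i c i) => i; rewrite rowK.
Qed.

(** Expressing [b] through [e] and then [e] through [b] gives [b] back with coefficients [Q *m P];
    freeness of [b] forces this product to be the identity. *)
Lemma basis_change d d' (b : 'I_d -> A) (e : 'I_d' -> A) :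
  basis_mod I b -> spans_mod I e ->
  exists (P : 'M_(d', d)) (Q : 'M_(d, d')),
    (forall i, I (e i - comb (row i P) b)) /\ Q *m P = 1%:M.
Proof.
move=> [bs bf] es; have [P eP] := spans_modP e bs.
have [Q bQ] := spans_modP b es; exists P, Q; split=> //.
apply/row_matrixP => i; rewrite row1; apply/subr0_eq/bf.
rewrite combB comb_delta; apply: ideal_sym; apply: (ideal_trans (bQ i)).
by rewrite row_mul comb_mulmx; apply: ideal_comb.
Qed.

Lemma basis_mod_le d d' (b : 'I_d -> A) (e : 'I_d' -> A) :
  basis_mod I b -> spans_mod I e -> (d <= d')%N.
Proof. by move=> bb es; have [P [Q [_ /mulmx1_min]]] := basis_change bb es. Qed.

Lemma basis_mod_eq d d' (b : 'I_d -> A) (e : 'I_d' -> A) :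
  basis_mod I b -> basis_mod I e -> d = d'.
Proof.
by move=> bb eb; apply/eqP; rewrite eqn_leq (basis_mod_le bb eb.1) (basis_mod_le eb bb.1).
Qed.

(** With equal sizes [P] and [Q] are square, hence inverse on both sides. A relation [c] on [e]
    yields the relation [c *m P] on [b], which vanishes only if [c] does. *)
Lemma spans_mod_free d (b e : 'I_d -> A) :
  basis_mod I b -> spans_mod I e -> free_mod I e.
Proof.
move=> bb es c ce; have [P [Q [eP /mulmx1C PQ]]] := basis_change bb es.
suff cP : c *m P = 0 by rewrite -[c]mulmx1 -PQ mulmxA cP mul0mx.
apply: bb.2; rewrite comb_mulmx; apply: ideal_cong ce; apply: ideal_comb => i.
exact/ideal_sym.
Qed.

(** A nontrivial relation lets one member of a spanning family be dropped; induction on the size. *)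
Lemma basis_mod_exists d (e : 'I_d -> A) : spans_mod I e ->
  exists d' (b : 'I_d' -> A), basis_mod I b.
Proof.
elim: d e => [|d IH] e es.
  by exists 0%N, e; split=> // c _; apply: thinmx0.
have [ef|ne] := boolp.EM (free_mod I e); first by exists d.+1, e.
have [c [ce cN0]] : exists c, I (comb c e) /\ c <> 0.
  by apply: boolp.contrapT => H; apply: ne => c ce; apply: boolp.contrapT => c0; apply: H; exists c.
have [i ci] : exists i, c 0 i != 0.
  apply/existsP; apply: boolp.contrapT => /negP/existsPn H; apply: cN0; apply/rowP => i.
  by rewrite mxE; apply/eqP/negPn.
apply: (IH (e \o lift i)) => p; have [a pa] := es p.
(* Subtracting this multiple of the relation [c] cancels the coordinate [i]. *)
pose a' := a - (a 0 i / c 0 i) *: c.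
exists (\row_j a' 0 (lift i j)); apply: (ideal_trans pa).
have -> : comb (\row_j a' 0 (lift i j)) (e \o lift i) = comb a' e.
  rewrite /comb [RHS](bigD1_ord i) //= !mxE divfK // subrr scale0r add0r.
  by apply: eq_bigr => j _; rewrite mxE.
by rewrite combB opprB addrC subrK combZ; apply: idealZ.
Qed.

(** Cayley-Hamilton: multiplication by [p] acts on the spanning family through a matrix [X], whose
    characteristic polynomial kills [p] modulo [I]. *)
Lemma algebraic_mod d (b : 'I_d -> A) p : spans_mod I b ->
  exists2 f : {poly K}, f \is monic & I (horner_alg p f).
Proof.
case: d b => [|d] b bs.
  exists 1; first exact: monic1.
  by have [c] := bs (horner_alg p 1); rewrite /comb big_ord0 subr0.
have [X pX] := spans_modP (fun i => p * b i) bs.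
have pc c : I (p * comb c b - comb (c *m X) b).
  by rewrite comb_mull comb_mulmx; apply: ideal_comb.
have pf f c : I (horner_alg p f * comb c b - comb (c *m horner_mx X f) b).
  elim/poly_ind: f c => [|f k IH] c.
    by rewrite !rmorph0 mul0r mulmx0 comb0 subrr; apply: ideal0.
  rewrite !rmorphD !rmorphM /= horner_algX horner_mx_X horner_algC horner_mx_C.
  rewrite mulrDl mulmxDr combD opprD addrACA; apply: idealD.
    have /(idealMl p) := IH c; rewrite mulrBr mulrA [p * _]mulrC => H.
    by apply: ideal_trans H _; rewrite mulmxA; apply: pc.
  by rewrite mul_mx_scalar combZ mulr_algl subrr; apply: ideal0.
exists (char_poly X); first exact: char_poly_monic.
(* For the coordinates [c] of 1, the congruence [pf] turns the vanishing of the polynomial at [X]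
   into the desired membership. *)
have [c c1] := bs 1; have := pf (char_poly X) c.
rewrite Cayley_Hamilton mulmx0 comb0 subr0 => fc.
by rewrite -[horner_alg _ _]mulr1; apply: (ideal_cong _ fc); rewrite -mulrBr; apply: idealMl.
Qed.

End Ideal.

Lemma basis_mod_ext I I' d (e : 'I_d -> A) : (forall p, I p <-> I' p) ->
  basis_mod I e -> basis_mod I' e.
Proof.
move=> II' [es ef]; split=> [p|c /II' /ef //].
by have [c /II'] := es p; exists c.
Qed.

Lemma spans_mod_sub I I' d (e : 'I_d -> A) : (forall p, I p -> I' p) ->
  spans_mod I e -> spans_mod I' e.
Proof. by move=> II' es p; have [c /II'] := es p; exists c. Qed.

(** Chinese remainder: [a] is 1 modulo [I] and 0 modulo [I'], so the [a * b i] and [(1 - a) * b' j]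
    together form a basis modulo the intersection. *)
Lemma basis_mod_crt I I' a d d' (b : 'I_d -> A) (b' : 'I_d' -> A) :
  is_ideal I -> is_ideal I' -> I (1 - a) -> I' a ->
  basis_mod I b -> basis_mod I' b' ->
  exists e : 'I_(d + d') -> A, basis_mod (fun p => I p /\ I' p) e.
Proof.
move=> idI idI' a1 a0 [bs bf] [bs' bf'].
pose e k := match split k with inl i => a * b i | inr j => (1 - a) * b' j end.
have combE c c' : comb (row_mx c c') e = a * comb c b + (1 - a) * comb c' b'.
  rewrite /comb big_split_ord /= !mulr_sumr; congr (_ + _); apply: eq_bigr => i _.
    by rewrite row_mxEl /e (unsplitK (inl i)) scalerAr.
  by rewrite row_mxEr /e (unsplitK (inr i)) scalerAr.
have I_e c c' : I (comb (row_mx c c') e - comb c b).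
  rewrite combE.
  have -> : a * comb c b + (1 - a) * comb c' b' - comb c b =
    (comb c' b' - comb c b) * (1 - a) by ring.
  exact: idealMl.
have I'_e c c' : I' (comb (row_mx c c') e - comb c' b').
  rewrite combE.
  have -> : a * comb c b + (1 - a) * comb c' b' - comb c' b' =
    (comb c b - comb c' b') * a by ring.
  exact: idealMl.
exists e; split=> [p|c].
  have [c pc] := bs p; have [c' pc'] := bs' p; exists (row_mx c c'); split.
    exact: (ideal_trans idI pc (ideal_sym idI (I_e c c'))).
  exact: (ideal_trans idI' pc' (ideal_sym idI' (I'_e c c'))).
move: (lsubmx c) (rsubmx c) (hsubmxK c) => l k <- [Ic Ic'].
have -> : l = 0 by apply: bf; apply: (ideal_cong idI (ideal_sym idI (I_e l k)) Ic).
have -> : k = 0 by apply: bf'; apply: (ideal_cong idI' (ideal_sym idI' (I'_e l k)) Ic').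
exact: row_mx0.
Qed.

End IdealModulo.

(** * The Nullstellensatz for ideals of finite codimension *)

Section Adjoin.
Variables (K : closedFieldType) (A : comAlgType K).
Implicit Types (I : A -> Prop) (p q a t : A).

(** The ideal I + (a). *)
Definition ideal_adjoin I a q := exists t, I (q - t * a).

Lemma ideal_adjoin_ideal I a : is_ideal I -> is_ideal (ideal_adjoin I a).
Proof.
move=> idI; split=> [|p q [t pt] [t' qt']|b p [t pt]].
- by exists 0; rewrite mul0r subr0; apply: ideal0.
- exists (t + t'); have -> : p + q - (t + t') * a = (p - t * a) + (q - t' * a) by ring.
  exact: idealD.
- exists (b * t); have -> : b * p - b * t * a = b * (p - t * a) by ring.
  exact: idealMl.
Qed.

Lemma ideal_adjoin_sub I a p : I p -> ideal_adjoin I a p.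
Proof. by exists 0; rewrite mul0r subr0. Qed.

Lemma ideal_adjoin_mem I a : is_ideal I -> ideal_adjoin I a a.
Proof. by exists 1; rewrite mul1r subrr; apply: ideal0. Qed.

(** Each factor is invertible modulo [I], so the factors can be cancelled one by one until 1 is
    left. *)
Lemma ideal_prod_comaximal I (s : seq K) (F : K -> A) : is_ideal I ->
  (forall k, k \in s -> ideal_adjoin I (F k) 1) -> I (\prod_(k <- s) F k) -> I 1.
Proof.
move=> idI; elim: s => [|k s IH] H; first by rewrite big_nil.
rewrite big_cons; set P := \prod_(_ <- s) _ => FP.
apply: IH => [j js|]; first by apply: H; rewrite inE js orbT.
have [t Ht] := H k (mem_head k s); rewrite -/P.
have -> : P = P * (1 - t * F k) + t * (F k * P) by ring.
by apply: idealD => //; apply: idealMl.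
Qed.

(** Some monic f has f(p) in [I], and f splits into linear factors. If every p - k were invertible
    modulo [I], so would be their product f(p), and [I] would contain 1. *)
Lemma adjoin_value I d (e : 'I_d -> A) p : is_ideal I -> spans_mod I e -> ~ I 1 ->
  exists k : K, ~ ideal_adjoin I (p - k%:A) 1.
Proof.
move=> idI es I1; apply: boolp.contrapT => H; apply: I1.
have [f fm fp] := algebraic_mod idI p es.
have [s fE] := closed_field_poly_normal f.
apply: (@ideal_prod_comaximal _ s (fun k => p - k%:A)) => //.
  by move=> k _; apply: boolp.contrapT => Hk; apply: H; exists k.
move: fp; rewrite fE (monicP fm) scale1r rmorph_prod /=.
by under eq_bigr => k _ do rewrite rmorphB /= horner_algX horner_algC.
Qed.

End Adjoin.

Section Nullstellensatz.
Variables (K : closedFieldType) (n : nat).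
Implicit Types (J I : {mpoly K[n]} -> Prop) (p q : {mpoly K[n]}) (u v : {ffun 'I_n -> K}).

Lemma mpoly_sub_value I u p : is_ideal I -> (forall i, I ('X_i - (u i)%:A)) ->
  I (p - (p.@[u])%:A).
Proof.
move=> idI Iu.
have X m : I ('X_[m] - ('X_[m].@[u])%:A).
  rewrite mevalX mpolyXE_id -[(\prod_i _)%:A]/(in_alg {mpoly K[n]} _) rmorph_prod.
  apply: (big_rec2 (fun p q => I (p - q))).
    by rewrite subrr; apply: ideal0.
  move=> i a b _ ab; apply: (ideal_congM idI) => //.
  by rewrite rmorphXn; apply: ideal_congX.
elim/mpolyind: p => [|c m p _ _ IH]; first by rewrite meval0 scale0r subrr; apply: ideal0.
rewrite mevalD mevalZ scalerDl opprD addrACA -scalerA -scalerBr.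
by apply: idealD => //; apply: idealZ.
Qed.

Lemma common_zero I d (e : 'I_d -> {mpoly K[n]}) :
  is_ideal I -> spans_mod I e -> ~ I 1 ->
  exists u, forall p, I p -> p.@[u] = 0.
Proof.
move=> idI es I1.
(* The variables receive values one at a time, the enlarged ideal staying proper. *)
have H (s : seq 'I_n) : exists I' (u : {ffun 'I_n -> K}),
    [/\ is_ideal I', forall p, I p -> I' p, ~ I' 1 & forall i, i \in s -> I' ('X_i - (u i)%:A)].
  elim: s => [|i s [I' [u [id' sub' I'1 us]]]].
    by exists I, [ffun=> 0]; split.
  have [k k1] := adjoin_value 'X_i id' (spans_mod_sub sub' es) I'1.
  exists (ideal_adjoin I' ('X_i - k%:A)), [ffun j => if j == i then k else u j]; split=> //.
  - exact: ideal_adjoin_ideal.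
  - by move=> p /sub'; apply: ideal_adjoin_sub.
  - move=> j; rewrite inE ffunE; case: (eqVneq j i) => [-> _|_ /us].
      exact: ideal_adjoin_mem.
    exact: ideal_adjoin_sub.
have [I' [u [id' sub' I'1 us]]] := H (enum 'I_n).
exists u => p /sub' Ip; apply/eqP; apply: boolp.contrapT => /negP pu; apply: I'1.
(* Modulo [I'] a polynomial equals its value at [u], so a member of [I] with nonzero value would put
   1 in [I']. *)
have /(ideal_sym id')/(ideal_cong id')/(_ Ip) : I' (p - (p.@[u])%:A).
  by apply: mpoly_sub_value => // i; apply: us; rewrite mem_enum.
by move=> /(idealZ id' (p.@[u])^-1); rewrite scalerA mulVf // scale1r.
Qed.

End Nullstellensatz.

(** * Localization at a point *)

Section Localization.
Variables (K : closedFieldType) (n : nat).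
Local Notation S := {mpoly K[n]}.
Implicit Types (J I : S -> Prop) (p q : S) (u v : {ffun 'I_n -> K}).

(* The preimage in the polynomial ring of the extension of J to the local ring at u. *)
Definition local_part J u p := exists s : S, s.@[u] != 0 /\ J (s * p).

Lemma local_part_ideal J u : is_ideal J -> is_ideal (local_part J u).
Proof.
move=> idJ; split=> [|p q [s [su sp]] [t [tu tq]]|a p [s [su sp]]].
- by exists 1; rewrite meval1 oner_neq0 mulr0; split=> //; apply: ideal0.
- exists (s * t); rewrite mevalM mulf_neq0 //; split=> //.
  have -> : s * t * (p + q) = t * (s * p) + s * (t * q) by ring.
  by apply: idealD => //; apply: idealMl.
- by exists s; rewrite mulrCA; split=> //; apply: idealMl.
Qed.

Lemma local_part_sub J u p : is_ideal J -> J p -> local_part J u p.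
Proof. by move=> idJ Jp; exists 1; rewrite meval1 oner_neq0 mul1r. Qed.

Lemma local_idealE J u p : is_ideal J -> local_ideal J u (tofrac p) <-> local_part J u p.
Proof.
move=> idJ; split=> [[a [s [Ja su E]]]|[s [su sp]]].
  have s0 : s != 0 by apply: contraNneq su => ->; rewrite meval0.
  exists s; split=> //; suff -> : s * p = a by [].
  by apply/eqP; rewrite -tofrac_eq tofracM E mulrC divfK // tofrac_eq0.
have s0 : s != 0 by apply: contraNneq su => ->; rewrite meval0.
exists (s * p), s; split=> //.
by rewrite tofracM mulrC mulKf // tofrac_eq0.
Qed.

Lemma local_idealD J u (q q' : {fraction S}) : is_ideal J ->
  local_ideal J u q -> local_ideal J u q' -> local_ideal J u (q + q').
Proof.
move=> idJ [a [s [Ja su ->]]] [a' [s' [Ja' su' ->]]].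
have s0 : s != 0 by apply: contraNneq su => ->; rewrite meval0.
have s0' : s' != 0 by apply: contraNneq su' => ->; rewrite meval0.
exists (a * s' + a' * s), (s * s'); rewrite mevalM mulf_neq0 //; split=> //.
  by apply: (idealD idJ); apply: (idealMr idJ).
by rewrite addf_div ?tofrac_eq0 // tofracD !tofracM.
Qed.

Lemma local_idealMl J u p (q : {fraction S}) : is_ideal J ->
  local_ideal J u q -> local_ideal J u (tofrac p * q).
Proof.
move=> idJ [a [s [Ja su ->]]]; exists (p * a), s; split=> //; first exact: idealMl.
by rewrite tofracM mulrA.
Qed.

Lemma local_ideal0 J u : is_ideal J -> local_ideal J u 0.
Proof.
move=> idJ; exists 0, 1; rewrite meval1 oner_neq0; split=> //; first exact: ideal0.
by rewrite tofrac0 mul0r.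
Qed.

Lemma meval_horner_alg p (f : {poly K}) u :
  (horner_alg p f).@[u] = f.[p.@[u]].
Proof.
elim/poly_ind: f => [|f c IH]; first by rewrite rmorph0 meval0 horner0.
by rewrite rmorphD rmorphM /= horner_algX horner_algC mevalD mevalM mevalZ meval1 IH
  mulr1 !hornerE.
Qed.

(* p satisfies an equation f(p) = 0 modulo J; the powers of X dividing f can be cancelled at u,
   where p is invertible. *)
Lemma local_part_algebraic J d (e : 'I_d -> S) u p :
  is_ideal J -> spans_mod J e -> p.@[u] != 0 ->
  exists2 g : {poly K}, g.[0] != 0 & local_part J u (horner_alg p g).
Proof.
move=> idJ es pu; have [f fm fp] := algebraic_mod idJ p es.
have [k [g]] := multiplicity_XsubC f 0; rewrite (monic_neq0 fm) => g0 fE.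
exists g; first exact: g0; exists (p ^+ k); rewrite rmorphXn expf_neq0 //; split=> //.
by move: fp; rewrite fE rmorphM rmorphXn subr0 /= horner_algX mulrC.
Qed.

(** Writing g(p) = g(0) + p h(p) with g(0) nonzero and g(p) in the local part, the inverse of [p] is
    -h(p)/g(0). *)
Lemma local_part_unit J d (e : 'I_d -> S) u p :
  is_ideal J -> spans_mod J e -> p.@[u] != 0 ->
  exists t, local_part J u (1 - p * t).
Proof.
move=> idJ es pu; have [g g0 gp] := local_part_algebraic idJ es pu.
have /factor_theorem[h hE] : root (g - g.[0]%:P) 0 by rewrite /root !hornerE subrr.
exists (- g.[0]^-1 *: horner_alg p h).
have -> : 1 - p * (- g.[0]^-1 *: horner_alg p h) = g.[0]^-1 *: horner_alg p g.
  rewrite -[X in _ = _ *: horner_alg _ X](subrK g.[0]%:P) hE subr0 rmorphD rmorphM /=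
     horner_algX horner_algC.
  by rewrite scalerDr scalerA mulVf // scale1r -scalerAr scaleNr opprK mulrC addrC.
exact: (idealZ (local_part_ideal u idJ)) gp.
Qed.

(** The polynomial p = X_i - v_i vanishes at [v] but not at [u]. Hence some g(p) lies in the local
    part at [u] while its value g(0) at [v] is nonzero, and g(p) times its inverse at [v] separates
    the two points. *)
Lemma local_part_comaximal J d (e : 'I_d -> S) u v :
  is_ideal J -> spans_mod J e -> u != v ->
  exists a, local_part J u a /\ local_part J v (1 - a).
Proof.
move=> idJ es uv.
have [i ui] : exists i, u i != v i.
  apply/existsP; apply: contraNT uv => /existsPn H.
  by apply/eqP/ffunP => i; apply/eqP/negPn.
pose p : S := 'X_i - (v i)%:MP.
have pE w : p.@[w] = w i - v i by rewrite mevalB mevalXU mevalC.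
have [|g g0 gp] := local_part_algebraic (u := u) (p := p) idJ es.
  by rewrite pE subr_eq0.
have [|t tP] := local_part_unit (u := v) (p := horner_alg p g) idJ es.
  by rewrite meval_horner_alg pE subrr.
exists (horner_alg p g * t); split=> //.
exact: (idealMr (local_part_ideal u idJ)).
Qed.

(** The product of the elements separating [u] from each point of [s]. *)
Lemma local_part_comaximal_seq J d (e : 'I_d -> S) u (s : seq {ffun 'I_n -> K}) :
  is_ideal J -> spans_mod J e -> u \notin s ->
  exists a, local_part J u (1 - a) /\ forall v, v \in s -> local_part J v a.
Proof.
move=> idJ es; have idu := local_part_ideal u idJ.
elim: s => [|v s IH]; first by exists 1; rewrite subrr; split=> //; apply: ideal0.
rewrite inE negb_or eq_sym => /andP[vu /IH[a [ua sa]]].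
have [b [vb ub]] := local_part_comaximal idJ es vu.
exists (a * b); split=> [|w].
  have -> : 1 - a * b = (1 - a) + a * (1 - b) by ring.
  by apply: idealD => //; apply: idealMl.
rewrite inE => /orP[/eqP ->|/sa wa]; first exact: (idealMl (local_part_ideal v idJ)).
exact: (idealMr (local_part_ideal w idJ)).
Qed.

Lemma basis_mod_local_parts J d (e : 'I_d -> S) (s : seq {ffun 'I_n -> K}) mu :
  is_ideal J -> spans_mod J e -> uniq s ->
  (forall u, u \in s -> exists b : 'I_(mu u) -> S, basis_mod (local_part J u) b) ->
  exists b : 'I_(\sum_(u <- s) mu u) -> S,
    basis_mod (fun p => forall u, u \in s -> local_part J u p) b.
Proof.
move=> idJ es; elim: s => [|u s IH] /=.
  (* With no points the intersection is the whole ring and the quotient is zero. *)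
  rewrite big_nil => _ _; exists (fun=> 0); split=> [p|c _]; last exact: thinmx0.
  by exists 0.
move=> /andP[us uqs] H; rewrite big_cons.
have [b bb] := H u (mem_head u s).
have [|b' bb'] := IH uqs; first by move=> v vs; apply: H; rewrite inE vs orbT.
have [a [ua sa]] := local_part_comaximal_seq idJ es us.
have ids : is_ideal (fun p => forall v, v \in s -> local_part J v p).
  split=> [v _|p q H1 H2 v vs|c p H1 v vs]; have idv := local_part_ideal v idJ.
  - exact: ideal0.
  - by apply: idealD; [|apply: H1|apply: H2].
  - by apply: idealMl => //; apply: H1.
have [f fb] := basis_mod_crt (local_part_ideal u idJ) ids ua sa bb bb'.
exists f; apply: basis_mod_ext fb => p; split=> [[up sp] v|H1].
  by rewrite inE => /orP[/eqP ->|/sp].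
by split=> [|v vs]; apply: H1; rewrite inE ?eqxx ?vs ?orbT.
Qed.

(** A proper colon ideal (J : p) would have a common zero [u], also a zero of [J]; yet membership of
    [p] in the local part at [u] gives an element of this colon ideal not vanishing at [u]. *)
Lemma local_global J d (e : 'I_d -> S) p : is_ideal J -> spans_mod J e ->
  (forall u, (forall q, J q -> q.@[u] = 0) -> local_part J u p) -> J p.
Proof.
move=> idJ es H; apply: boolp.contrapT => Jp.
pose I q := J (q * p).
have idI : is_ideal I.
  split=> [|q q' Iq Iq'|a q Iq]; rewrite /I.
  - by rewrite mul0r; apply: ideal0.
  - by rewrite mulrDl; apply: idealD.
  - by rewrite -mulrA; apply: idealMl.
have JI q : J q -> I q by apply: idealMr.
have [|u uI] := common_zero idI (spans_mod_sub JI es); first by rewrite /I mul1r.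
have [s [su /uI sp]] := H u (fun q Jq => uI q (JI q Jq)).
by rewrite sp eqxx in su.
Qed.

(** The denominator [s] has a polynomial inverse [t] modulo the local part, so a/s is represented by
    a t. *)
Lemma local_ring_poly J d (e : 'I_d -> S) u (q : {fraction S}) : is_ideal J -> spans_mod J e ->
  local_ring u q -> exists p, local_ideal J u (q - tofrac p).
Proof.
move=> idJ es [a [s [su ->]]].
have [t [w [wu wJ]]] := local_part_unit idJ es su.
have s0 : s != 0 by apply: contraNneq su => ->; rewrite meval0.
have w0 : w != 0 by apply: contraNneq wu => ->; rewrite meval0.
(* The difference a/s - a t equals a (1 - s t)/s, and [w] carries 1 - s t into [J]. *)
exists (a * t), (a * (w * (1 - s * t))), (w * s).
rewrite mevalM mulf_neq0 //; split=> //; first exact: idealMl.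
have -> : a * (w * (1 - s * t)) = w * (a * (1 - s * t)) by ring.
rewrite [tofrac (w * _)]tofracM [tofrac (w * s)]tofracM -mulf_div.
rewrite divff ?tofrac_eq0 // mul1r.
apply: (canRL (mulfK _)); rewrite ?tofrac_eq0 // mulrBl divfK ?tofrac_eq0 //.
by rewrite -!tofracM -tofracB; congr tofrac; ring.
Qed.

(** Every class of the local ring modulo J has a polynomial representative, so this quotient is the
    polynomial ring modulo [local_part J u]. *)
Lemma multiplicityP J d (e : 'I_d -> S) u m : is_ideal J -> spans_mod J e ->
  multiplicity J u m <-> exists b : 'I_m -> S, basis_mod (local_part J u) b.
Proof.
move=> idJ es.
have comb_frac (b : 'I_m -> S) (c : 'I_m -> K) :
    tofrac (comb (\row_i c i) b) = \sum_i tofrac (c i)%:MP * tofrac (b i).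
  rewrite /comb rmorph_sum; apply: eq_bigr => i _.
  by rewrite mxE -mul_mpolyC rmorphM.
split=> [[f [fR fs ff]]|[b [bs bf]]].
  have /fin_all_exists[b bP] := fun i => local_ring_poly idJ es (fR i).
  have fb c : local_ideal J u (\sum_i tofrac (c i)%:MP * f i - tofrac (comb (\row_i c i) b)).
    rewrite comb_frac -sumrB; apply: big_ind => [|q q'|i _]; first exact: local_ideal0.
      exact: local_idealD.
    by rewrite -mulrBr; apply: local_idealMl.
  exists b; split=> [p|c].
    have [|c pc] := fs (tofrac p); first by exists p, 1; rewrite meval1 oner_neq0 tofrac1 divr1.
    exists (\row_i c i); apply/(local_idealE _ _ idJ).
    by have := local_idealD idJ pc (fb c); rewrite addrA subrK -tofracB.
  move=> /(local_idealE _ _ idJ) cb; apply/rowP => i; rewrite mxE.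
  apply: (ff (fun i => c 0 i)); have := local_idealD idJ (fb (fun i => c 0 i)) cb.
  suff -> : \row_i c 0 i = c by rewrite subrK.
  by apply/rowP => j; rewrite mxE.
exists (fun i => tofrac (b i)); split=> [i|q qR|c].
- by exists (b i), 1; rewrite meval1 oner_neq0 tofrac1 divr1.
- have [p qp] := local_ring_poly idJ es qR; have [c /(local_idealE _ _ idJ) pc] := bs p.
  exists (fun i => c 0 i); rewrite -comb_frac.
  have -> : \row_i c 0 i = c by apply/rowP => j; rewrite mxE.
  by have := local_idealD idJ qp pc; rewrite tofracB addrA subrK.
- rewrite -comb_frac => /(local_idealE _ _ idJ) /bf /rowP H i.
  by have := H i; rewrite !mxE.
Qed.

End Localization.

(** * Polynomial systems with finitely many solutions *)

Section GeneratedIdeal.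
Variables (K : fieldType) (n : nat) (T : finType) (F : T -> {mpoly K[n]}).
Local Notation J := (ideal_gen F).

Lemma ideal_gen_ideal : is_ideal J.
Proof.
split=> [|p q [a ->] [b ->]|c p [a ->]].
- by exists (fun=> 0); rewrite big1 // => t _; rewrite mul0r.
- exists (fun t => a t + b t); rewrite -big_split.
  by apply: eq_bigr => t _; rewrite mulrDl.
- exists (fun t => c * a t); rewrite mulr_sumr.
  by apply: eq_bigr => t _; rewrite mulrA.
Qed.

Lemma ideal_gen_mem t : J (F t).
Proof.
exists (fun t' => (t' == t)%:R); rewrite (bigD1 t) //= eqxx mul1r big1 ?addr0 //.
by move=> t' /negPf ->; rewrite mul0r.
Qed.

Lemma ideal_gen_min (I : {mpoly K[n]} -> Prop) p : is_ideal I ->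
  (forall t, I (F t)) -> J p -> I p.
Proof.
move=> idI IF [a ->]; apply: (ideal_sum idI) => t _.
exact: (idealMl idI).
Qed.

Lemma solution_ideal_gen u p : solution F u -> J p -> p.@[u] = 0.
Proof.
move=> su; apply: (ideal_gen_min (I := fun p => p.@[u] = 0)) => //.
split=> [|q q' Hq Hq'|a q Hq]; first exact: meval0.
  by rewrite mevalD Hq Hq' addr0.
by rewrite mevalM Hq mulr0.
Qed.

End GeneratedIdeal.

Section FiniteSystem.
Variables (K : closedFieldType) (n : nat) (T : finType) (F : T -> {mpoly K[n]}).
Variables (d : nat) (e : 'I_d -> {mpoly K[n]}).
Hypothesis es : spans_mod (ideal_gen F) e.
Let idJ := ideal_gen_ideal F.

(** Each coordinate of a solution is a root of a fixed polynomial f with f(X_i) in the ideal, so the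
    solutions lie in a finite grid. *)
Lemma finite_solutions :
  exists2 s : seq {ffun 'I_n -> K}, uniq s & forall u, u \in s <-> solution F u.
Proof.
have /fin_all_exists[r rP] (i : 'I_n) : exists r : seq K, forall u, solution F u -> u i \in r.
  have [f fm fJ] := algebraic_mod idJ 'X_i es.
  have [r fE] := closed_field_poly_normal f; exists r => u /solution_ideal_gen /(_ fJ).
  rewrite meval_horner_alg mevalXU => /eqP; rewrite -/(root f (u i)) fE (monicP fm) scale1r.
  by rewrite root_prod_XsubC.
pose L := flatten [seq r i | i <- enum 'I_n].
pose s : seq {ffun 'I_n -> K} := [seq [ffun i => val (w i)] | w : {ffun 'I_n -> seq_sub L}].
exists (undup [seq u : {ffun 'I_n -> K} <- s | [forall t, (F t).@[u] == 0]]).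
  exact: undup_uniq.
move=> u; rewrite mem_undup mem_filter; split=> [/andP[/forallP H _] t|H].
  exact/eqP.
apply/andP; split; first by apply/forallP => t; apply/eqP.
have uL i : u i \in L.
  by apply/flattenP; exists (r i); [rewrite map_f ?mem_enum | apply: rP].
apply/imageP; exists [ffun i => SeqSub (uL i)] => //.
by apply/ffunP => i; rewrite !ffunE.
Qed.

(** By [local_global] the intersection of the local parts at the solutions is the ideal itself, so
    the local bases assemble into a basis modulo it. *)
Lemma solutions_basis (s : seq {ffun 'I_n -> K}) mu : uniq s ->
  (forall u, u \in s <-> solution F u) ->
  (forall u, u \in s -> multiplicity (ideal_gen F) u (mu u)) ->
  exists b : 'I_(\sum_(u <- s) mu u) -> {mpoly K[n]}, basis_mod (ideal_gen F) b.
Proof.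
move=> us sP muP.
have [|b bb] := basis_mod_local_parts (mu := mu) idJ es us.
  by move=> u /muP /(multiplicityP _ _ idJ es).
exists b; apply: basis_mod_ext bb => p; split=> [H|Jp u _]; last exact: local_part_sub.
apply: (local_global idJ es) => u uJ; apply: H; apply/sP => t.
exact/uJ/ideal_gen_mem.
Qed.

Lemma multiplicity_exists u : exists m, multiplicity (ideal_gen F) u m.
Proof.
have sub p : ideal_gen F p -> local_part (ideal_gen F) u p by apply: local_part_sub.
have [m [b bb]] := basis_mod_exists (local_part_ideal u idJ) (spans_mod_sub sub es).
by exists m; apply/(multiplicityP _ _ idJ es); exists b.
Qed.

(** The multiplicities add up to the size of a basis, and all bases have the same size. *)
Lemma has_solutions_with_multP r :
  has_solutions_with_mult F r <->
  exists b : 'I_r -> {mpoly K[n]}, basis_mod (ideal_gen F) b.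
Proof.
split=> [[s [mu [us sP muP <-]]]|[b bb]]; first exact: solutions_basis.
have [s us sP] := finite_solutions.
have [mu muP] := boolp.choice multiplicity_exists.
exists s, mu; split=> //.
have [b' bb'] := solutions_basis us sP (fun u _ => muP u).
exact: (basis_mod_eq idJ bb' bb).
Qed.

End FiniteSystem.

(** * The first independent monomials *)

Section GradedLex.
Variable n : nat.
Implicit Types m t : 'X_{1..n}.

Lemma grlex_ltP m1 m2 :
  reflect ((mdeg m1 < mdeg m2)%N \/ mdeg m1 = mdeg m2 /\
     exists i : 'I_n, (m2 i < m1 i)%N /\ forall j : 'I_n, (j < i)%N -> m1 j = m2 j)
  (grlex_lt m1 m2).
Proof.
apply: (iffP orP) => -[H|H]; try by left.
  right; case/andP: H => /eqP dm /existsP[i /andP[mi /forallP Hi]].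
  by split=> //; exists i; split=> // j ji; apply/eqP; apply: (implyP (Hi j)).
right; case: H => -> [i [mi Hi]]; rewrite eqxx; apply/existsP; exists i.
by rewrite mi; apply/forallP => j; apply/implyP => /Hi ->.
Qed.

Lemma grlex_lt_irr : irreflexive (@grlex_lt n).
Proof. by move=> m; apply/negP => /grlex_ltP[|[_ [i []]]]; rewrite ltnn. Qed.

Lemma grlex_lt_trans : transitive (@grlex_lt n).
Proof.
move=> m2 m1 m3 /grlex_ltP[d12|[d12 [i [mi Hi]]]] /grlex_ltP[d23|[d23 [j [mj Hj]]]];
  apply/grlex_ltP.
- by left; apply: ltn_trans d12 d23.
- by left; rewrite -d23.
- by left; rewrite d12.
right; split; first by rewrite d12.
case: (ltngtP i j) => [ij|ji|/val_inj ij].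
- by exists i; rewrite -Hj //; split=> // k ki; rewrite Hi // Hj // (ltn_trans ki).
- by exists j; rewrite Hi //; split=> // k kj; rewrite Hi ?Hj // (ltn_trans kj).
exists i; split=> [|k ki]; first by apply: ltn_trans mi; rewrite ij.
by rewrite Hi // Hj // -ij.
Qed.

Lemma grlex_ltD t m1 m2 : grlex_lt m1 m2 -> grlex_lt (m1 + t)%MM (m2 + t)%MM.
Proof.
move=> /grlex_ltP H; apply/grlex_ltP; rewrite !mdegD ltn_add2r.
case: H => [|[-> [i [mi Hi]]]]; [by left | right; split=> //; exists i].
by rewrite !mnmDE ltn_add2r; split=> // j /Hi; rewrite !mnmDE => ->.
Qed.

Lemma grlex_lt_mdeg m1 m2 : (mdeg m1 < mdeg m2)%N -> grlex_lt m1 m2.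
Proof. by move=> d; apply/grlex_ltP; left. Qed.

End GradedLex.

Section FirstIndep.
Variables (K : fieldType) (n r : nat) (I : {mpoly K[n]} -> Prop) (beta : r.-tuple 'X_{1..n}).
Hypotheses (idI : is_ideal I) (betaP : first_indep I beta).
Implicit Types (m t : 'X_{1..n}) (p : {mpoly K[n]}).

Lemma first_indep_uniq : uniq beta.
Proof.
by case: betaP => + _ _; apply: sorted_uniq; [apply: grlex_lt_trans | apply: grlex_lt_irr].
Qed.

Let lin (c : 'X_{1..n} -> K) : {mpoly K[n]} := \sum_(b <- beta) c b *: 'X_[b].

(** The span modulo [I] of the kept monomials below [m]. The coefficients are cut off at [m] while
    the sum runs over all of [beta], so combinations add without reindexing. *)
Let low m p := exists c : 'X_{1..n} -> K,
  (forall b, ~~ grlex_lt b m -> c b = 0) /\ I (p - lin c).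

Let lin_delta m : m \in beta -> lin (fun b => (b == m)%:R) = 'X_[m].
Proof.
move=> mb; rewrite /lin (bigD1_seq m) ?first_indep_uniq //= eqxx scale1r.
by rewrite big1 ?addr0 // => b /negPf ->; rewrite scale0r.
Qed.

Let lowZ m k p : low m p -> low m (k *: p).
Proof.
move=> [c [c0 cI]]; exists (fun b => k * c b); split=> [b /c0 ->|]; first by rewrite mulr0.
suff -> : lin (fun b => k * c b) = k *: lin c by rewrite -scalerBr; apply: idealZ.
by rewrite /lin scaler_sumr; apply: eq_bigr => b _; rewrite scalerA.
Qed.

Let lowD m p q : low m p -> low m q -> low m (p + q).
Proof.
move=> [c [c0 cI]] [c' [c0' cI']]; exists (fun b => c b + c' b); split=> [b bm|].
  by rewrite c0 // c0' // addr0.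
suff -> : lin (fun b => c b + c' b) = lin c + lin c'.
  by rewrite opprD addrACA; apply: idealD.
by rewrite /lin -big_split; apply: eq_bigr => b _; rewrite scalerDl.
Qed.

Let low0 m : low m 0.
Proof.
exists (fun=> 0); split=> //; rewrite /lin big1 ?subrr => [|b _]; last by rewrite scale0r.
exact: ideal0.
Qed.

(** A passed monomial satisfies a relation with smaller kept ones. Its own coefficient is nonzero
    because the kept monomials are independent, so the relation can be solved for it. *)
Let low_passed m : m \notin beta -> has (grlex_lt m) beta -> low m 'X_[m].
Proof.
move=> mb hm; case: betaP => _ ind /(_ m mb hm) nind.
set s := rcons _ m in nind.
have [c [cI [m0 [m0s cm0]]]] : exists c, I (\sum_(b <- s) c b *: 'X_[b]) /\
    exists m0, m0 \in s /\ c m0 <> 0.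
  apply: boolp.contrapT => H; apply: nind => c cI m0 m0s.
  by apply: boolp.contrapT => cm0; apply: H; exists c; split=> //; exists m0.
pose c' b := if grlex_lt b m then c b else 0.
have cE : \sum_(b <- s) c b *: 'X_[b] = lin c' + c m *: 'X_[m].
  rewrite /s -cats1 big_cat big_seq1 big_filter big_mkcond /=; congr (_ + _).
  by apply: eq_bigr => b _; rewrite /c'; case: ifP => // _; rewrite scale0r.
rewrite cE in cI.
have cm : c m != 0.
  apply: contra_notN cm0 => /eqP cm; move: m0s; rewrite mem_rcons inE mem_filter.
  case/orP => [/eqP -> //|/andP[m0m m0b]].
  have := ind c' _ m0 m0b; rewrite /c' m0m; apply.
  by move: cI; rewrite cm scale0r addr0.
exists (fun b => - (c m)^-1 * c' b); split=> [b /negPf bm|]; first by rewrite /c' bm mulr0.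
have -> : 'X_[m] - lin (fun b => - (c m)^-1 * c' b) = (c m)^-1 *: (lin c' + c m *: 'X_[m]).
  rewrite scalerDr scalerA mulVf // scale1r addrC; congr (_ + _).
  rewrite /lin scaler_sumr -sumrN; apply: eq_bigr => b _.
  by rewrite mulNr scaleNr opprK scalerA.
exact: idealZ.
Qed.

Let low_lt m k : m \in beta -> grlex_lt k m -> low m 'X_[k].
Proof.
move=> mb km; have [kb|kb] := boolP (k \in beta).
  exists (fun b => (b == k)%:R); split=> [b|].
    by case: eqP => // ->; rewrite km.
  by rewrite lin_delta // subrr; apply: ideal0.
have [|c [c0 cI]] := low_passed kb; first by apply/hasP; exists m.
exists c; split=> // b bm; apply: c0; apply: contra bm => bk.
exact: grlex_lt_trans bk km.
Qed.

(** If [m] had been passed over, multiplying its expression in smaller monomials by ['X_i] would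
    express the kept monomial [k] through smaller kept ones, against independence. *)
Lemma first_indep_closed m i : (m + U_(i))%MM \in beta -> m \in beta.
Proof.
set k := (m + _)%MM => kb; apply: boolp.contrapT => /negP mb.
have mk : grlex_lt m k by apply: grlex_lt_mdeg; rewrite mdegD mdeg1 addn1.
have [|c [c0 cI]] := low_passed mb; first by apply/hasP; exists k.
have [c1 [c10 c1I]] : low k (lin c * 'X_i).
  rewrite /lin mulr_suml; apply: big_ind => [||b _]; [exact: low0 | exact: lowD |].
  have [bm|/c0 ->] := boolP (grlex_lt b m); last by rewrite scale0r mul0r.
  by rewrite -scalerAl -mpolyXD; apply/lowZ/low_lt/grlex_ltD.
have kI : I ('X_[k] - lin c1).
  apply: (ideal_trans idI _ c1I); rewrite mpolyXD -mulrBl.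
  exact: idealMr.
case: betaP => _ ind _.
have : (k == k)%:R - c1 k = 0.
  apply: (ind (fun b => (b == k)%:R - c1 b)) => //.
  move: kI; rewrite -(lin_delta kb) /lin -sumrB.
  by under eq_bigr => b _ do rewrite -scalerBl.
by move/eqP; rewrite eqxx c10 ?grlex_lt_irr // subr0 oner_eq0.
Qed.

Lemma first_indep_unit : (0 < r)%N -> 0%MM \in beta.
Proof.
move=> r0; have [b bb] : exists b, b \in beta.
  by exists (tnth beta (Ordinal r0)); apply: mem_tnth.
move dE: (mdeg b) => d; elim: d b bb dE => [|d IH] b bb dE.
  by move/eqP: dE; rewrite mdeg_eq0 => /eqP <-.
have [i [m [bE md]]] := mnm_pred dE.
by apply: (IH m) => //; apply: (@first_indep_closed m i); rewrite -bE.
Qed.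

End FirstIndep.

(** * The border system *)

Section CommutingSubstitution.
Variables (K : fieldType) (n r : nat) (X : 'I_n -> 'M[K]_r.+1).
Hypothesis XC : forall i j, GRing.comm (X i) (X j).
Implicit Types (p q : {mpoly K[n]}) (m : 'X_{1..n}).

Local Notation subst := (mmap (@scalar_mx K r.+1) X).

Lemma mmap1D_comm m1 m2 : mmap1 X (m1 + m2) = mmap1 X m1 * mmap1 X m2.
Proof.
rewrite /mmap1 -prodrM_comm => [|i j _ _]; last exact/commrX/commr_sym/commrX.
by apply: eq_bigr => i _; rewrite mnmDE exprD.
Qed.

Lemma mmapM_comm p q : subst (p * q) = subst p * subst q.
Proof.
have scalC c (M : 'M[K]_r.+1) : M * c%:M = c%:M * M by exact: scalar_mxC.
have substXM m p' : subst ('X_[m] * p') = mmap1 X m * subst p'.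
  elim/mpolyind: p' => [|c m' p' _ _ IH]; first by rewrite mulr0 mmap0 mulr0.
  rewrite mulrDr !mmapD -scalerAr -mpolyXD IH !mmapZ !mmapX mmap1D_comm mulrDr.
  by rewrite !mulrA scalC.
elim/mpolyind: p => [|c m p _ _ IH]; first by rewrite mul0r mmap0 mul0r.
by rewrite mulrDl !mmapD IH -scalerAl !mmapZ substXM mmapX mulrDl mulrA.
Qed.

End CommutingSubstitution.

(** * Multiplication by the variables modulo the border system *)

Section Border.
Variables (K : fieldType) (n r : nat) (beta : r.-tuple 'X_{1..n}).
Variable G : 'I_r -> seq_sub (border beta) -> K.
Hypotheses (beta_uniq : uniq beta) (beta1 : 0%MM \in beta).
Implicit Types (p q : {mpoly K[n]}) (m : 'X_{1..n}).

Local Notation J := (ideal_gen (phi G)).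
Local Notation b := (fun t => 'X_[tnth beta t] : {mpoly K[n]}).
Let idJ := ideal_gen_ideal (phi G).

Lemma tnth_beta_eq (s t : 'I_r) : (tnth beta s == tnth beta t) = (s == t).
Proof. by apply/eqP/eqP => [/(tuple_uniqP _ beta_uniq)|->]. Qed.

Lemma comb_msupp p : {subset msupp p <= beta} ->
  p = comb (\row_t p@_(tnth beta t)) b.
Proof.
move=> pb; apply/mpolyP => m; rewrite /comb raddf_sum /=.
under eq_bigr => t _ do rewrite mxE mcoeffZ mcoeffX.
have [/tnthP[t ->]|mb] := boolP (m \in beta).
  rewrite (bigD1 t) //= eqxx mulr1 big1 ?addr0 // => s st.
  by rewrite tnth_beta_eq (negPf st) mulr0.
rewrite memN_msupp_eq0; last by apply: contra mb => /pb.
rewrite big1 // => t _; case: eqP => [E|]; last by rewrite mulr0.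
by rewrite -E mem_tnth in mb.
Qed.

Lemma spans_border bd : perm_eq bd (border beta) -> spans_mod J b.
Proof.
move=> bdE p; exists (\row_t (NF G bd p)@_(tnth beta t)).
rewrite -comb_msupp; first exact: NF_mod.
exact: NF_span.
Qed.

Lemma mem_borderU t i : (tnth beta t + U_(i))%MM \notin beta ->
  (tnth beta t + U_(i))%MM \in border beta.
Proof.
move=> tb; rewrite mem_filter tb; apply/mem_expand; right.
by exists i, (tnth beta t); rewrite mem_tnth.
Qed.

Lemma gcoef_border s (a : seq_sub (border beta)) : gcoef G s (val a) = G s a.
Proof. by rewrite /gcoef valK. Qed.

Lemma mult_mx_in i s t u : (tnth beta t + U_(i))%MM = tnth beta u ->
  mult_mx G i s t = (s == u)%:R.
Proof. by move=> E; rewrite mxE /= E mem_tnth tnth_beta_eq. Qed.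

Lemma mult_mx_border i s t (a : seq_sub (border beta)) :
  (tnth beta t + U_(i))%MM = val a -> mult_mx G i s t = G s a.
Proof.
move=> E; rewrite mxE /= E gcoef_border; have := valP a.
by rewrite mem_filter => /andP[/negPf ->].
Qed.

(** Column t of [mult_mx G i] holds the coordinates of the t-th monomial times ['X_i]: exactly if
    the product is in [beta], modulo a generator if it is in the border. The transpose appears
    because coordinates are rows. *)
Lemma mult_mx_mod i c : J ('X_i * comb c b - comb (c *m (mult_mx G i)^T) b).
Proof.
rewrite comb_mull comb_mulmx; apply: (ideal_comb idJ) => t.
rewrite mulrC -mpolyXD; have [/tnthP[u E]|tb] := boolP ((tnth beta t + U_(i))%MM \in beta).
  suff -> : row t (mult_mx G i)^T = delta_mx 0 u by rewrite comb_delta E subrr; apply: ideal0.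
  by apply/rowP => s; rewrite 2!mxE (mult_mx_in s E) mxE eqxx.
pose a : seq_sub (border beta) := SeqSub (mem_borderU tb).
suff -> : comb (row t (mult_mx G i)^T) b = phi G a + 'X_[val a].
  rewrite opprD addrCA subrr addr0; apply: (idealN idJ).
  exact: ideal_gen_mem.
rewrite subrK /comb; apply: eq_bigr => s _.
by rewrite 2!mxE (@mult_mx_border _ _ _ a).
Qed.

(** Both products give coordinates of the same polynomial modulo J, and freeness makes coordinates
    unique. *)
Lemma free_mult_mxC i j : free_mod J b ->
  mult_mx G i *m mult_mx G j = mult_mx G j *m mult_mx G i.
Proof.
move=> bf; apply/trmx_inj/row_matrixP => t; rewrite !trmx_mul !rowE.
apply/subr0_eq/bf; rewrite combB !mulmxA; set c := delta_mx _ _.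
have step k l : J ('X_l * ('X_k * comb c b) - comb (c *m (mult_mx G k)^T *m (mult_mx G l)^T) b).
  apply: (ideal_trans idJ) (mult_mx_mod l _); rewrite -mulrBr.
  exact: (idealMl idJ) (mult_mx_mod k c).
apply: (ideal_trans idJ) (ideal_sym idJ (step j i)) _.
by rewrite mulrCA; apply: step.
Qed.

End Border.

Lemma free_mult_mx (K : fieldType) (n r : nat) (beta : r.-tuple 'X_{1..n})
    (G : 'I_r -> seq_sub (border beta) -> K) :
  uniq beta -> 0%MM \in beta ->
  (forall m i, (m + U_(i))%MM \in beta -> m \in beta) ->
  (forall i j, mult_mx G i *m mult_mx G j = mult_mx G j *m mult_mx G i) ->
  free_mod (ideal_gen (phi G)) (fun t => 'X_[tnth beta t]).
Proof.
case: r beta G => [|r] beta G ub b1 closed MC c; first by rewrite [c]thinmx0.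
pose X i := (mult_mx G i)^T.
have XC i j : GRing.comm (X i) (X j).
  by rewrite /GRing.comm /X -!mulmxE -!trmx_mul MC.
have /tnthP[o oE] := b1.
(* The polynomial [p], evaluated at the matrices [X], is applied to the coordinate vector of the
   monomial 1, whose position in [beta] is [o]. *)
pose act p := delta_mx 0 o *m mmap (@scalar_mx K r.+1) X p : 'rV_r.+1.
have act_sum (T : finType) (F : T -> {mpoly K[n]}) : act (\sum_t F t) = \sum_t act (F t).
  by apply: (big_morph act) => [p q|]; rewrite /act ?mmapD ?mulmxDr // mmap0 mulmx0.
have actZ k p : act (k *: p) = k *: act p.
  by rewrite /act mmapZ -mulmxE -scalar_mxC mulmxA mul_mx_scalar.
have actM p q : act (p * q) = act p *m mmap (@scalar_mx K r.+1) X q.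
  by rewrite /act mmapM_comm // -mulmxE mulmxA.
have actXU t i : act 'X_[tnth beta t] = delta_mx 0 t ->
    act 'X_[(tnth beta t + U_(i))] = row t (X i).
  by move=> E; rewrite mpolyXD actM E mmapX mmap1U -rowE.
(* Induction on the degree: closure under division provides a predecessor in [beta], and multiplying
   by a variable inside [beta] moves a unit vector to a unit vector. *)
have act_beta t : act 'X_[tnth beta t] = delta_mx 0 t.
  move dE: (mdeg (tnth beta t)) => d; elim: d t dE => [|d IH] t dE.
    have tE : tnth beta t = 0%MM by apply/eqP; rewrite -mdeg_eq0 dE.
    have -> : t = o by apply/eqP; rewrite -(tnth_beta_eq ub) tE oE.
    by rewrite -oE /act mmapX mmap11 mulmx1.
  have [i [m [tE md]]] := mnm_pred dE.
  have /tnthP[u uE] : m \in beta by apply: (closed m i); rewrite -tE mem_tnth.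
  rewrite tE uE actXU; last by apply: IH; rewrite -uE.
  apply/rowP => s; rewrite 2!mxE (@mult_mx_in _ _ _ _ _ ub _ _ _ t) ?mxE ?eqxx //.
  by rewrite -uE -tE.
(* A border monomial is a member of [beta] times a variable, so its image is a row of some [X i],
   which lists the coefficients of [G] at [a]. *)
have act_phi a : act (phi G a) = 0.
  have [t [i tE]] : exists t i, (tnth beta t + U_(i))%MM = val a.
    have := valP a; rewrite mem_filter => /andP[/negPf aN /mem_expand[|[i [m [/tnthP[t ->] ->]]]]].
      by rewrite /= aN.
    by exists t, i.
  rewrite /phi {1}/act raddfB mulmxBr -/(act _) -/(act _) act_sum -tE actXU //.
  apply/rowP => s; rewrite !mxE summxE (bigD1 s) //= actZ act_beta !mxE !eqxx mulr1.
  rewrite big1 ?addr0 => [|u us]; last by rewrite actZ act_beta !mxE eq_sym (negPf us) andbF mulr0.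
  by rewrite -(mult_mx_border G s tE) mxE subrr.
have act_comb : act (comb c (fun t => 'X_[tnth beta t])) = c.
  rewrite /comb act_sum [RHS]row_sum_delta; apply: eq_bigr => t _.
  by rewrite actZ act_beta.
(* The action sends the combination to [c], but kills every multiple of a generator, so [c] is
   zero. *)
rewrite -{2}act_comb => -[f ->]; rewrite act_sum big1 // => t _.
by rewrite mulrC actM act_phi mul0mx.
Qed.

(** * Vanishing ideals and closedness of the dehomogenized variety *)

Lemma vanishing_ideal_ideal (K : fieldType) n (Y : {ffun 'I_n -> K} -> Prop) :
  is_ideal (vanishing_ideal Y).
Proof.
split=> [y _|p q pY qY y Yy|a p pY y Yy]; first exact: meval0.
  by rewrite mevalD pY // qY // addr0.
by rewrite mevalM pY // mulr0.
Qed.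

(** The dehomogenized equations themselves belong to the vanishing ideal. *)
Lemma dehomog_variety_closed (K : fieldType) n M (h : 'I_M -> {mpoly K[n.+1]})
    (y : {ffun 'I_n -> K}) :
  (forall p, vanishing_ideal (dehomog_variety h) p -> p.@[y] = 0) ->
  dehomog_variety h y.
Proof.
move=> H k; pose hd : {mpoly K[n]} :=
  h k \mPo [tuple if unlift ord0 j is Some i then 'X_i else 1 | j < n.+1].
have hdE (z : {ffun 'I_n -> K}) : hd.@[z] = (h k).@[affine_chart z].
  rewrite comp_mpoly_meval; apply: meval_eq => j; rewrite tnth_mktuple /affine_chart.
  by case: (unlift _ _) => [i|]; rewrite ?mevalXU ?meval1.
by rewrite -hdE; apply: H => z Yz; rewrite hdE.
Qed.

Theorem theorem4p5 (R : realType) (n M N r : nat)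
  (h : 'I_M -> {mpoly R[i][n.+1]})
  (g : 'I_N -> {mpoly R[i][n]})
  (beta : r.-tuple 'X_{1..n})
  (bd : seq 'X_{1..n})
  (h_homog : forall k, exists d : nat, h k \is d.-homog)
  (r_gt0 : (0 < r)%N)
  (beta_first : first_indep (vanishing_ideal (dehomog_variety h)) beta)
  (g_gen : forall p : {mpoly R[i][n]},
     vanishing_ideal (dehomog_variety h) p <-> ideal_gen g p)
  (bd_enum : perm_eq bd (border beta))
  (G : 'I_r -> seq_sub (border beta) -> R[i]) :
  (has_solutions_with_mult (phi G) r /\
   solutions_belong_with_mult (phi G) (dehomog_variety h))
  <->
  ((forall i j : 'I_n, (i < j)%N ->
      commutator (mult_mx G i) (mult_mx G j) = 0) /\
   (forall k : 'I_N, NF G bd (g k) = 0)).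
Proof.
have idI := vanishing_ideal_ideal (dehomog_variety h).
have ub := first_indep_uniq beta_first.
have b1 := first_indep_unit idI beta_first r_gt0.
have idJ := ideal_gen_ideal (phi G).
have bs := spans_border G ub b1 bd_enum.
split=> [[/(has_solutions_with_multP bs)[e eb] YP]|[MC NF0]].
  (* The r monomials of B_0 span a quotient of dimension r, hence are independent in it. *)
  have bf := spans_mod_free idJ eb bs.
  split=> [i j _|k]; first by rewrite /commutator (free_mult_mxC ub) // subrr.
  have Jg : ideal_gen (phi G) (g k).
    apply: (local_global idJ bs) => u uJ; apply/(local_idealE _ _ idJ).
    have [|_] := YP u; first by move=> t; apply/uJ/ideal_gen_mem.
    by apply; apply/g_gen/ideal_gen_mem.
  have NFE := comb_msupp ub (NF_span (G := G) bd_enum b1 (p := g k)).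
  suff row0 : \row_t (NF G bd (g k))@_(tnth beta t) = 0 by rewrite NFE row0 comb0.
  (* The normal form lies in J together with [g k], and it is a combination of the independent
     monomials of B_0. *)
  apply: bf; rewrite -NFE; have := idealB idJ Jg (NF_mod G bd_enum b1 (g k)).
  by rewrite opprB addrC subrK.
(* Zero normal forms put all generators, hence all of I(Y), into J. *)
have Jg p : vanishing_ideal (dehomog_variety h) p -> ideal_gen (phi G) p.
  move=> /g_gen; apply: ideal_gen_min => // k.
  by have := NF_mod G bd_enum b1 (g k); rewrite NF0 subr0.
split.
  apply/(has_solutions_with_multP bs); exists (fun t => 'X_[tnth beta t]); split=> //.
  apply: free_mult_mx => // [m i|i j]; first exact: first_indep_closed idI beta_first m i.
  (* Commutation is given for i < j only; the other cases follow by symmetry or are trivial. *)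
  case: (ltngtP i j) => [ij|ji|/val_inj -> //]; first exact/subr0_eq/MC.
  exact/esym/subr0_eq/MC.
move=> u su; split=> [|p /Jg Jp].
  (* A solution annihilates J, hence I(Y), and is therefore a point of Y. *)
  by apply: dehomog_variety_closed => p /Jg; apply: solution_ideal_gen.
by apply/(local_idealE _ _ idJ); apply: local_part_sub.
Qed.
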